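(* Let $a\ge1$ and $n\ge1$ be odd integers. Then the center of $\Pi^a_n$ consists of a single vertex: $Z(\Pi^a_n)=\{\hat\epsilon\}$, where $\hat\epsilon=\epsilon\epsilon\cdots\epsilon$ is the word of length $n$ all of whose letters equal $\epsilon=\lfloor a/2\rfloor$.
   Context: For integers $a\ge 1$ and $n\ge 0$, let $\mathcal{S}^a_n$ be the set of all words $\alpha_1\cdots\alpha_n$ of length $n$ over the alphabet $\{0,1,\dots,a\}$ such that the letter $a$ appears only immediately after a letter $0$ (so $\alpha_1\ne a$, and $\alpha_i=a$ implies $\alpha_{i-1}=0$). The metallic cube $\Pi^a_n$ is the simple graph with vertex set $\mathcal{S}^a_n$ in which two vertices $\alpha,\beta$ are adjacent if and only if $\sum_{k=1}^n|\alpha_k-\beta_k|=1$, i.e. one is obtained from the other by replacing a single letter $k$ by $k+1$, $0\le k\le a-1$. For a connected graph $G$, $d(v,w)$ is the shortest-path distance, $e(v)=\max_{w\in V(G)}d(v,w)$ is the eccentricity of $v$, $r(G)=\min_{v\in V(G)}e(v)$ is the radius, and the center is $Z(G)=\{v\in V(G): e(v)=r(G)\}$. *)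

(* Defs.v *)
From mathcomp Require Import all_boot all_algebra.
Set Implicit Arguments.
Unset Strict Implicit.
Unset Printing Implicit Defensive.

(* A graph on a finite type [T] is given by its adjacency relation [e]. *)

(* Length of a shortest walk from [x] to [y].  A shortest walk has fewer than
   #|T| edges, so the search is exhaustive; if [y] is not reachable from [x]
   the value is #|T|, larger than every genuine distance. *)
Definition gdist (T : finType) (e : rel T) (x y : T) : nat :=
  find (fun k => [exists p : k.-tuple T, path e x p && (last x p == y)])
       (iota 0 #|T|).

Definition eccentricity (T : finType) (e : rel T) (v : T) : nat :=
  \max_(w : T) gdist e v w.

(* #|T| bounds every eccentricity, so as the default element it does not
   affect the minimum. *)
Definition gradius (T : finType) (e : rel T) : nat :=
  \big[minn/#|T|]_(v : T) eccentricity e v.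

Definition gcenter (T : finType) (e : rel T) : {set T} :=
  [set v | eccentricity e v == gradius e].

(* No predecessor [j] exists for the first position, so the first letter of
   such a word is not [a]. *)
Definition is_metallic (a n : nat) (w : n.-tuple 'I_a.+1) : bool :=
  [forall i : 'I_n, (tnth w i == a :> nat) ==>
    [exists j : 'I_n, (j.+1 == i :> nat) && (tnth w j == 0 :> nat)]].

Definition metallic_word (a n : nat) : finType :=
  {w : n.-tuple 'I_a.+1 | is_metallic w}.

Definition metallic_adj (a n : nat) : rel (metallic_word a n) :=
  fun v w => \sum_(k < n) `|tnth (val v) k - tnth (val w) k|%N == 1.

Arguments metallic_adj : clear implicits.

Definition eps_tuple (a n : nat) : n.-tuple 'I_a.+1 :=
  [tuple of nseq n (inord a./2)].

Lemma eps_tuple_metallic (a n : nat) : 1 <= a -> is_metallic (eps_tuple a n).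
Proof.
move=> a_ge1; have half_a : a./2 < a by rewrite -divn2 ltn_Pdiv.
apply/forallP=> i; apply/implyP.
rewrite (tnth_nth ord0) /= nth_nseq ltn_ord inordK; last exact: ltnW.
by rewrite ltn_eqF.
Qed.

Definition eps_word (a n : nat) (a_ge1 : 1 <= a) : metallic_word a n :=
  exist _ (eps_tuple a n) (eps_tuple_metallic n a_ge1).

(* Main.v *)
Require Import Defs.
From mathcomp Require Import all_boot all_algebra.
From mathcomp Require Import zify.

Set Implicit Arguments.
Unset Strict Implicit.
Unset Printing Implicit Defensive.

(** Write [a = 2m+1] and [n = 2h+1], so that the candidate centre is the word
    [m...m].

    Lowering letters never destroys metallicity: a surviving letter [a] was
    already there, and the [0] before it cannot have been lowered
    ([is_metallic_lower]).  Hence from [v] one can always make one step towards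
    [w]: lower a letter of [v] that exceeds that of [w], or, if [v <= w]
    letterwise, raise any letter that differs, the result being still below [w]
    ([metallic_step_towards]).  The graph distance is therefore the
    l1-distance ([gdist_metallic]), and the rest is about words.

    From [m...m], a letter of [w] is at distance at most [m], except that a
    letter [a] is at distance [m+1].  In a metallic word of length [n] there are
    at most [h] letters [a], each being preceded by a [0], so the eccentricity of
    [m...m] is at most [n*m + h] ([l1_nseq_le]).

    Any other word [v] has a metallic word at distance at least [n*m + h + 1].
    Such a word is put together from blocks without constraint between them
    ([reaches_cat]): single letters [0] or [2m], which gain at least [m], and at
    least [m+1] against a letter other than [m]; and pairs facing letters [x, y],
    filled with [0a] or with two single letters, which gain at least [2m+1].
    Cutting [v] into one single letter and [h] pairs gives [n*m + h], and
    the cut can be chosen so that some block gains one more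
    ([reaches_gt]).  So [m...m] is the only word of minimal
    eccentricity ([gcenter_eq1]). *)

(** * Distances and centres in finite graphs *)

Section FiniteGraph.
Variables (T : finType) (e : rel T).

Lemma gdist_eq (x y : T) (k : nat) :
    (exists p : k.-tuple T, path e x p && (last x p == y)) ->
    (forall p, path e x p -> last x p = y -> k <= size p) ->
  gdist e x y = k.
Proof.
move=> [p /andP[e_p /eqP last_p]] k_min.
(* Removing the loops of the walk [p] leaves at most #|T| vertices, so [k] lies
   in the range searched by [gdist]. *)
have k_lt : k < #|T|.
  move: last_p; case/shortenP: e_p => q e_q uniq_q _ last_q.
  apply: leq_ltn_trans (k_min q e_q last_q) _.
  by rewrite -[(size q).+1]/(size (x :: q)) -(card_uniqP uniq_q) max_card.
rewrite /gdist; set P := (fun k : nat => _).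
have Pk : P k by apply/existsP; exists p; rewrite e_p last_p /=.
have has_P : has P (iota 0 #|T|) by apply/hasP; exists k; rewrite ?mem_iota.
have find_lt : find P (iota 0 #|T|) < #|T|.
  by rewrite -[X in _ < X](size_iota 0) -has_find.
apply/eqP; rewrite eqn_leq; apply/andP; split.
  rewrite leqNgt; apply/negP=> /(before_find 0).
  by rewrite nth_iota // add0n Pk.
have := nth_find 0 has_P; rewrite nth_iota // add0n.
case/existsP=> q /andP[e_q /eqP last_q].
by rewrite -[X in _ <= X](size_tuple q) k_min.
Qed.

Lemma eccentricity_le_card (v : T) : eccentricity e v <= #|T|.
Proof.
apply/bigmax_leqP=> w _.
by rewrite -[X in _ <= X](size_iota 0) find_size.
Qed.

Lemma gcenter_eq1 (c : T) :
    (forall v, v != c -> eccentricity e c < eccentricity e v) ->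
  gcenter e = [set c].
Proof.
move=> c_min; have le_c v : eccentricity e c <= eccentricity e v.
  by have [->//|/c_min/ltnW] := eqVneq v c.
suff radius_c : gradius e = eccentricity e c.
  apply/setP=> v; rewrite !inE radius_c; apply/eqP/eqP => [ecc_v|->//].
  by apply/eqP/negPn/negP=> /c_min; rewrite ecc_v ltnn.
apply/eqP; rewrite eqn_leq /gradius; apply/andP; split; last first.
  apply: (big_ind (fun r => eccentricity e c <= r)) => //.
    exact: eccentricity_le_card.
  by move=> r1 r2; rewrite leq_min => -> ->.
have := mem_index_enum c; elim: (index_enum T) => // v s IHs.
rewrite inE big_cons geq_min => /orP[/eqP<-|/IHs ->]; first by rewrite leqnn.
by rewrite orbT.
Qed.

End FiniteGraph.

(** * The l1-distance between sequences *)

Definition l1 (s t : seq nat) : nat :=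
  \sum_(k < size s) `|nth 0 s k - nth 0 t k|%N.

Lemma l1_nil t : l1 [::] t = 0.
Proof. by rewrite /l1 big_ord0. Qed.

Lemma l1_cons x s y t : l1 (x :: s) (y :: t) = `|x - y|%N + l1 s t.
Proof. by rewrite /l1 /= big_ord_recl. Qed.

Lemma l1_cat s1 s2 t1 t2 :
  size t1 = size s1 -> l1 (s1 ++ s2) (t1 ++ t2) = l1 s1 t1 + l1 s2 t2.
Proof.
elim: s1 t1 => [|x s1 IHs] [|y t1] //=; first by rewrite l1_nil.
by case=> size_t1; rewrite !l1_cons IHs // addnA.
Qed.

(** * The graph distance is the l1-distance *)

Section Metallic.
Variables a n : nat.
Implicit Types (v w : metallic_word a n).

Definition letters v : seq nat := [seq val x | x <- val v].

Lemma size_letters v : size (letters v) = n.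
Proof. by rewrite size_map size_tuple. Qed.

Lemma nth_letters v (k : 'I_n) : nth 0 (letters v) k = tnth (val v) k.
Proof.
rewrite (nth_map (tnth (val v) k)) ?size_tuple //.
by rewrite -tnth_nth.
Qed.

Lemma letters_inj : injective letters.
Proof. by move=> v w /(inj_map val_inj) vw; apply/val_inj/val_inj. Qed.

Lemma l1_letters v w :
  l1 (letters v) (letters w) = \sum_(k < n) `|tnth (val v) k - tnth (val w) k|%N.
Proof.
by rewrite /l1 size_letters; apply: eq_bigr => k _; rewrite !nth_letters.
Qed.

Lemma metallic_adjE v w :
  metallic_adj a n v w = (l1 (letters v) (letters w) == 1).
Proof. by rewrite l1_letters. Qed.

Lemma l1_eq0 v w : l1 (letters v) (letters w) = 0 -> v = w.
Proof.
rewrite l1_letters => /eqP; rewrite sum_nat_eq0 => /forallP vw.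
apply/val_inj/eq_from_tnth => k; apply/val_inj => /=.
by have /= := vw k; lia.
Qed.

Lemma l1_triangle u v w :
  l1 (letters u) (letters w) <=
    l1 (letters u) (letters v) + l1 (letters v) (letters w).
Proof. by rewrite !l1_letters -big_split /=; apply: leq_sum => k _; lia. Qed.

Lemma is_metallic_lower (s t : n.-tuple 'I_a.+1) :
  (forall k, tnth s k <= tnth t k) -> is_metallic t -> is_metallic s.
Proof.
move=> le_st /forallP t_ok; apply/forallP=> i; apply/implyP=> /eqP s_i.
have t_i : tnth t i == a :> nat.
  by have := le_st i; have := ltn_ord (tnth t i); lia.
have := t_ok i; rewrite t_i => /existsP[j /andP[ji /eqP t_j]].
apply/existsP; exists j; rewrite ji /=.
by have := le_st j; lia.
Qed.

Definition set_letter (v : n.-tuple 'I_a.+1) (i : 'I_n) (c : 'I_a.+1) :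
  n.-tuple 'I_a.+1 := [tuple if k == i then c else tnth v k | k < n].

Lemma l1_set_letter v v' w i c :
    val v' = set_letter (val v) i c ->
    `|tnth (val v) i - c|%N = 1 ->
    `|tnth (val v) i - tnth (val w) i|%N = (`|c - tnth (val w) i|%N).+1 ->
  metallic_adj a n v v' /\
  l1 (letters v) (letters w) = (l1 (letters v') (letters w)).+1.
Proof.
move=> v'E vi_c closer; rewrite metallic_adjE !l1_letters v'E.
rewrite (bigD1 i) //= tnth_mktuple eqxx vi_c big1 => [|k /negPf k_i]; last first.
  by rewrite tnth_mktuple k_i; lia.
split=> //; rewrite (bigD1 i) //= [in RHS](bigD1 i) //= tnth_mktuple eqxx closer.
rewrite addSn; congr (_ + _).+1; apply: eq_bigr => k /negPf k_i.
by rewrite tnth_mktuple k_i.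
Qed.

(** Letters of [v] above those of [w] are lowered first, since the result stays
    below [v]; once [v <= w], raising a letter stays below [w].  Either way the
    new word lies below a metallic word. *)
Lemma metallic_step_towards v w : v != w ->
  exists2 v', metallic_adj a n v v' &
    l1 (letters v) (letters w) = (l1 (letters v') (letters w)).+1.
Proof.
move=> v_neq_w.
suff [i [c [ok vi_c closer]]] : exists i c,
    [/\ is_metallic (set_letter (val v) i c), `|tnth (val v) i - c|%N = 1 &
     `|tnth (val v) i - tnth (val w) i|%N = (`|c - tnth (val w) i|%N).+1].
  pose v' : metallic_word a n := Sub _ ok.
  by have [] := @l1_set_letter v v' w i c erefl vi_c closer; exists v'.
have [/existsP[i lt_wv]|/existsPn le_vw] :=
    boolP [exists i, tnth (val w) i < tnth (val v) i].
  have [c cE] : exists c : 'I_a.+1, c = (tnth (val v) i).-1 :> nat.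
    have c_lt : (tnth (val v) i).-1 < a.+1 by have := ltn_ord (tnth (val v) i); lia.
    by exists (Ordinal c_lt).
  exists i, c; split; [|by rewrite cE; lia..].
  apply: is_metallic_lower (valP v) => k; rewrite tnth_mktuple.
  by have [->|_] := eqVneq k i => //; rewrite cE leq_pred.
have [i lt_vw] : exists i, tnth (val v) i < tnth (val w) i.
  apply/existsP; apply: contraNT v_neq_w => /existsPn le_wv.
  apply/eqP/val_inj/eq_from_tnth=> k; apply/val_inj => /=.
  by have := le_vw k; have := le_wv k; rewrite -!leqNgt /=; lia.
have [c cE] : exists c : 'I_a.+1, c = (tnth (val v) i).+1 :> nat.
  have c_lt : (tnth (val v) i).+1 < a.+1 by have := ltn_ord (tnth (val w) i); lia.
  by exists (Ordinal c_lt).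
exists i, c; split; [|by rewrite cE; lia..].
apply: is_metallic_lower (valP w) => k; rewrite tnth_mktuple.
by have [->|_] := eqVneq k i; [rewrite cE | rewrite leqNgt le_vw].
Qed.

Lemma l1_le_path v p :
  path (metallic_adj a n) v p -> l1 (letters v) (letters (last v p)) <= size p.
Proof.
elim: p v => [|u p IHp] v /=.
  by move=> _; rewrite l1_letters big1 // => k _; lia.
rewrite metallic_adjE => /andP[/eqP vu /IHp le_p].
by apply: leq_trans (l1_triangle v u _) _; rewrite vu.
Qed.

Lemma gdist_metallic v w :
  gdist (metallic_adj a n) v w = l1 (letters v) (letters w).
Proof.
apply: gdist_eq => [|p e_p <-]; last exact: l1_le_path.
move def_d: (l1 _ _) => d; elim: d v def_d => [|d IHd] v def_d.
  by exists [tuple]; rewrite /= (l1_eq0 def_d).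
have [|v' vv' v'w] := @metallic_step_towards v w.
  by apply: contra_eq_neq def_d => ->; rewrite l1_letters big1 // => k _; lia.
have [|p /andP[e_p last_p]] := IHd v'; first by move: v'w; rewrite def_d => -[].
by exists [tuple of v' :: p]; rewrite /= vv' e_p last_p.
Qed.

End Metallic.

(** * Metallic words as paths *)

Definition metallic_step (a : nat) : rel nat := fun x y => (y == a) ==> (x == 0).

(** The starting point [1] is an arbitrary nonzero letter placed before the word,
    which forbids [a] in first position. *)
Lemma is_metallicE (a n : nat) (w : n.-tuple 'I_a.+1) :
  is_metallic w = path (metallic_step a) 1 [seq val x | x <- w].
Proof.
have nthE (i : 'I_n) : nth 0 [seq val x | x <- w] i = tnth w i.
  rewrite (nth_map (tnth w i)) ?size_tuple //.
  by rewrite -tnth_nth.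
apply/forallP/(pathP 0) => [ok i | ok i].
  rewrite size_map size_tuple => i_lt; apply/implyP.
  rewrite (nthE (Ordinal i_lt)) => w_i.
  have := ok (Ordinal i_lt); rewrite w_i /= => /existsP[j /andP[/eqP ji w_j]].
  by rewrite -ji /= nthE.
apply/implyP=> w_i; have := ok i; rewrite size_map size_tuple ltn_ord.
move/(_ isT); rewrite /metallic_step nthE w_i /=.
case i_eq: (val i) => [|j] //= w_j.
have j_lt : j < n by have := ltn_ord i; move: i_eq => /=; lia.
apply/existsP; exists (Ordinal j_lt); rewrite -nthE w_j andbT /=.
by apply/eqP.
Qed.

Lemma path_letters (a n : nat) (w : metallic_word a n) :
  path (metallic_step a) 1 (letters w).
Proof. by rewrite -is_metallicE; apply: valP. Qed.

Lemma metallic_wordP (a n : nat) (s : seq nat) :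
    size s = n -> all (leq^~ a) s -> path (metallic_step a) 1 s ->
  exists w : metallic_word a n, letters w = s.
Proof.
move=> size_s /all_nthP le_a s_path.
pose t : n.-tuple 'I_a.+1 := [tuple inord (nth 0 s k) | k < n].
have tE : [seq val x | x <- t] = s.
  apply: (@eq_from_nth _ 0) => [|k]; rewrite size_map size_tuple // => k_lt.
  rewrite (nth_map ord0) ?size_tuple // -[k]/(val (Ordinal k_lt)) -tnth_nth.
  by rewrite tnth_mktuple /= inordK // ltnS le_a ?size_s.
have ok : is_metallic t by rewrite is_metallicE tE.
by exists (Sub t ok : metallic_word a n).
Qed.

(** * Eccentricities *)

Section Eccentricity.
Variable m : nat.
Let a := (m.*2).+1.

(** The bound allows for the letter [p] before the word: after a [0] one more
    letter [a] may start it, whence the boolean [p == 0].  Each step of the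
    induction then reads one letter. *)
Lemma l1_nseq_le p s :
    path (metallic_step a) p s -> all (leq^~ a) s ->
  l1 (nseq (size s) m) s <= size s * m + ((size s + (p == 0))./2).
Proof.
elim: s p => [|x s IHs] p /=; first by rewrite l1_nil.
move=> /andP[px /IHs{}IHs] /andP[x_le /IHs].
rewrite l1_cons mulSn; move: px; rewrite /metallic_step /a in x_le *.
by case: (p =P 0); case: (x =P 0); case: eqP; lia.
Qed.

(** The path condition holds after every letter so that the words witnessing it
    can be concatenated. *)
Definition reaches (s : seq nat) (g : nat) : Prop :=
  exists t, [/\ size t = size s, all (leq^~ a) t,
                forall p, path (metallic_step a) p t & g <= l1 s t].

Lemma reaches_cat s1 s2 g1 g2 :
  reaches s1 g1 -> reaches s2 g2 -> reaches (s1 ++ s2) (g1 + g2).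
Proof.
move=> [t1 [size1 le1 path1 far1]] [t2 [size2 le2 path2 far2]].
exists (t1 ++ t2); split.
- by rewrite !size_cat size1 size2.
- by rewrite all_cat le1.
- by move=> p; rewrite cat_path path1 path2.
- by rewrite l1_cat // leq_add.
Qed.

Lemma reaches_le s g g' : g <= g' -> reaches s g' -> reaches s g.
Proof.
move=> le_g [t [size_t le_t path_t far_t]]; exists t; split=> //.
exact: leq_trans far_t.
Qed.

Lemma reaches1 x : reaches [:: x] (m + (x != m)).
Proof.
exists [:: if x <= m then m.*2 else 0]; split=> //=.
- by rewrite andbT; case: (leqP x m) => _; rewrite /a ?leqnSn.
- move=> p; rewrite andbT; apply/implyP; rewrite /a; case: (leqP x m) => _; lia.
- by rewrite l1_cons l1_nil; case: (leqP x m); case: eqP; lia.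
Qed.

Lemma reaches_0a x y : reaches [:: x; y] (x + (a - y)).
Proof.
exists [:: 0; a]; split=> //=; first by rewrite leqnn.
  by move=> p; rewrite /metallic_step eqxx andbT; apply/implyP; rewrite /a; lia.
by rewrite !l1_cons l1_nil; lia.
Qed.

Lemma reaches2 x y : reaches [:: x; y] (m.*2).+1.
Proof.
have [xm|xm] := eqVneq x m; last first.
  apply: reaches_le (reaches_cat (reaches1 x) (reaches1 y)).
  by rewrite xm; lia.
have [ym|ym] := eqVneq y m; last first.
  apply: reaches_le (reaches_cat (reaches1 x) (reaches1 y)).
  by rewrite ym; lia.
by apply: reaches_le (reaches_0a x y); rewrite /a; lia.
Qed.

(** Against the block [0a], a letter [y < m] in second place, or a letter [x > m]
    in first place, is worth one more than [m] would be.  For [x > m] and [y > m]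
    two single letters already gain [m+1] each. *)
Lemma reaches2_gt x y :
  (x == m) && (y < m) || (m < x) -> reaches [:: x; y] (m.*2).+2.
Proof.
case/orP=> [/andP[/eqP xm y_lt]|x_gt].
  by apply: reaches_le (reaches_0a x y); rewrite /a; lia.
have [y_le|y_gt] := leqP y m.
  by apply: reaches_le (reaches_0a x y); rewrite /a; lia.
apply: reaches_le (reaches_cat (reaches1 x) (reaches1 y)).
by rewrite !neq_ltn x_gt y_gt !orbT; lia.
Qed.

Lemma reaches_ge s : reaches s (size s * m + (size s)./2).
Proof.
have [k] := ubnP (size s); elim: k s => // k IHk [|x [|y s]] /= size_s.
- by exists [::]; split; rewrite //= l1_nil.
- by apply: reaches_le (reaches1 x); lia.
- apply: reaches_le (reaches_cat (reaches2 x y) (IHk s _)); last by lia.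
  by rewrite !mulSn; lia.
Qed.

(** The first letter [x] differing from [m] decides the cut.  Reading in
    pairs, if [x] opens a pair it is taken as the single letter; otherwise [x] ends
    a pair [m x] and gains one more there if [x < m], or, if [x > m], when paired
    with the following letter instead, the [m] before it being the single
    letter. *)
Lemma reaches_gt (s : seq nat) : odd (size s) -> s != nseq (size s) m ->
  reaches s (size s * m + (size s)./2).+1.
Proof.
have [k] := ubnP (size s); elim: k s => // k IHk [|x s] //= size_s odd_s s_neq.
have [xm|xm] := eqVneq x m; last first.
  apply: reaches_le (reaches_cat (reaches1 x) (reaches_ge s)).
  by rewrite xm mulSn; lia.
case: s => [|y s] /= in size_s odd_s s_neq *.
  by move: s_neq; rewrite xm eqxx.
have [y_lt|y_gt|ym] := ltngtP y m.
- apply: reaches_le (reaches_cat (reaches2_gt (x := x) (y := y) _) (reaches_ge s)).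
    by rewrite !mulSn; lia.
  by rewrite xm eqxx y_lt.
- case: s => [|z s] /= in size_s odd_s s_neq *; first by [].
  have pair := @reaches2_gt y z; rewrite y_gt orbT in pair.
  apply: reaches_le
    (reaches_cat (reaches1 x) (reaches_cat (pair isT) (reaches_ge s))).
  by rewrite !mulSn; lia.
- have s_ne : s != nseq (size s) m.
    by apply: contraNneq s_neq => s_eq; rewrite xm ym {1}s_eq.
  apply: reaches_le (reaches_cat (reaches2 x y) (IHk s _ _ s_ne)); rewrite ?mulSn; lia.
Qed.

End Eccentricity.

Theorem corollary2 (a n : nat) (a_ge1 : 1 <= a) (n_ge1 : 1 <= n)
    (a_odd : odd a) (n_odd : odd n) :
  gcenter (metallic_adj a n) = [set eps_word n a_ge1].
Proof.
have aE : a = ((a./2).*2).+1 by rewrite -[LHS]odd_double_half a_odd.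
have epsE : letters (eps_word n a_ge1) = nseq n a./2.
  rewrite /letters /= map_nseq /= inordK //; lia.
apply: gcenter_eq1 => v v_neq.
apply: (@leq_ltn_trans (n * a./2 + n./2)).
  apply/bigmax_leqP=> w _; rewrite gdist_metallic epsE.
  have := @l1_nseq_le (a./2) 1 (letters w).
  rewrite -aE size_letters addn0; apply; first exact: path_letters.
  by apply/allP=> _ /mapP[x _ ->]; apply: (ltn_ord x).
have := @reaches_gt (a./2) (letters v).
rewrite size_letters -epsE (inj_eq (@letters_inj a n)).
case/(_ n_odd v_neq) => s []; rewrite -aE size_letters => size_s le_s path_s far_s.
have [w wE] := metallic_wordP size_s le_s (path_s 1).
apply: leq_trans far_s _; rewrite -wE -gdist_metallic.
exact: (leq_bigmax (F := gdist (metallic_adj a n) v)).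
Qed.
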